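(* Let $C_\phi$ be a composition operator on a directed graph with one circuit, with data $\kappa$, $\eta$, $(X,\mathscr A,\mu)$, $\phi$ as in the context, and suppose $\kappa>1$. Then the following are equivalent: (i) $C_\phi\in\boldsymbol B(L^2(\mu))$ and $C_\phi$ is $3$-isometric; (ii) there exist $M,t\in(0,\infty)$, a system of real polynomials $\{w_i\}_{i=1}^\eta$ of degree at most $1$, and two systems $\{c_i\}_{i=1}^\eta\subseteq(0,\infty)$ and $\{d_i\}_{i=1}^\eta\subseteq[0,\infty)$ with $w_i(j)=c_i+d_i(j-1)$ for all $i\in J_{[1,\eta]}$, $j\in\mathbb N$, such that $$\max\Big\{\sum_{i=1}^\eta w_i(1),\ \sup\Big\{\frac{w_i(j+1)}{w_i(j)}: i\in J_{[1,\eta]},\ j\in\mathbb N\Big\}\Big\}\le M,$$ $c:=\sum_{i=1}^\eta c_i<\infty$, $d:=\sum_{i=1}^\eta d_i<\infty$, and $$\mu(x_{i,j})=c_i+d_i(j-1),\quad i\in J_{[1,\eta]},\ j\in\mathbb N,\qquad \mu(x_i)=w^{\kappa,t}_{c,d}(i),\quad i\in\{1,\ldots,\kappa\},$$ where $w^{\kappa,t}_{c,d}$ is the polynomial of degree at most $2$ given by $$w^{\kappa,t}_{c,d}(x)=\frac{d}{2\kappa}x^2+\Big(\frac c\kappa-\frac{\kappa+2}{2\kappa}d\Big)x-c+d+t,\quad x\in\mathbb R.$$ Moreover, $C_\phi\in\boldsymbol B(L^2(\mu))$ is $2$-isometric if and only if (ii) holds with a system of polynomials $\{w_i\}_{i=1}^\eta$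 of degree equal to $0$ and with $d_i=0$ for all $i\in J_{[1,\eta]}$.
   Context: Setting. $\mathbb N=\{1,2,\ldots\}$. Let $\kappa\in\mathbb N$, $\eta\in\mathbb N\cup\{\infty\}$, $J_{[1,\eta]}=\{i\in\mathbb N: i\le\eta\}$ (so $J_{[1,\infty]}=\mathbb N$), and let $X=\{x_1,\ldots,x_\kappa\}\cup\{x_{i,j}: i\in J_{[1,\eta]},\, j\in\mathbb N\}$, all the listed points being distinct. Let $\mathscr A$ be the $\sigma$-algebra of all subsets of $X$ and $\mu$ a positive measure on $\mathscr A$ with $\mu(x):=\mu(\{x\})\in(0,\infty)$ for all $x\in X$. Define $\phi\colon X\to X$ by $\phi(x_{i,j})=x_{i,j-1}$ for $j\ge2$, $\phi(x_{i,1})=x_\kappa$, $\phi(x_1)=x_\kappa$, and $\phi(x_i)=x_{i-1}$ for $2\le i\le\kappa$. The operator $C_\phi f=f\circ\phi$ in the complex space $L^2(\mu)=L^2(X,\mathscr A,\mu)$ is called a composition operator on a directed graph with one circuit. $C_\phi\in\boldsymbol B(L^2(\mu))$ means that $C_\phi$ is everywhere defined and bounded on $L^2(\mu)$. A bounded operator $T$ on a Hilbert space is an $m$-isometry ($m$-isometric) if $\sum_{k=0}^m(-1)^k\binom mk T^{*k}T^k=0$. *)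

(* Defs.v *)
From HB Require Import structures.
From mathcomp Require Import all_boot all_order all_algebra.
From mathcomp Require Import complex.
From mathcomp Require Import all_classical all_reals all_analysis.
From mathcomp Require Import measurable_realfun.
From mathcomp Require Import ring.

Set Implicit Arguments.
Unset Strict Implicit.
Unset Printing Implicit Defensive.

Import Order.TTheory GRing.Theory Num.Theory.
Import numFieldNormedType.Exports.

Local Open Scope classical_set_scope.
Local Open Scope ring_scope.

Local Notation Re := (@complex.Re _).
Local Notation Im := (@complex.Im _).

(* The squared modulus, as an element of R; the norm `|z| of R[i] is itself
   complex-valued. *)
Definition sqmod (R : realType) (z : R[i]) : R := Re z ^+ 2 + Im z ^+ 2.

Definition cintegral (R : realType) (d : measure_display) (X : measurableType d)
    (mu : {measure set X -> \bar R}) (f : X -> R[i]) : R[i] :=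
  (Complex (\int[mu]_x Re (f x)) (\int[mu]_x Im (f x)))%R.

Definition square_integrable (R : realType) (d : measure_display)
    (X : measurableType d) (mu : {measure set X -> \bar R}) (f : X -> R[i]) : Prop :=
  [/\ measurable_fun setT (Re \o f), measurable_fun setT (Im \o f)
    & (\int[mu]_x (sqmod (f x))%:E < +oo)%E].

Definition square_integrable_pred (R : realType) (d : measure_display)
    (X : measurableType d) (mu : {measure set X -> \bar R}) : {pred X -> R[i]} :=
  fun f => `[< square_integrable mu f >].

(* Almost everywhere equal functions are not identified. For a measure without
   nonempty null sets, which is the only case of interest here, this is the
   usual L^2(mu): almost everywhere equality is then equality. *)
Record L2 (R : realType) (d : measure_display) (X : measurableType d)
    (mu : {measure set X -> \bar R}) := MkL2 {
  L2_val :> X -> R[i];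
  _ : L2_val \in square_integrable_pred mu }.

Section L2_lmodType.
Context (R : realType) (d : measure_display) (X : measurableType d).
Variable mu : {measure set X -> \bar R}.

HB.instance Definition _ := [isSub for @L2_val R d X mu].
HB.instance Definition _ := [Choice of L2 mu by <:].

Let ReZD (a z w : R[i]) : Re (a * z + w) = Re a * Re z - Im a * Im z + Re w.
Proof. by case: a z w => [? ?] [? ?] [? ?]. Qed.

Let ImZD (a z w : R[i]) : Im (a * z + w) = Re a * Im z + Im a * Re z + Im w.
Proof. by case: a z w => [? ?] [? ?] [? ?]. Qed.

Let sqmodZ (a z : R[i]) : sqmod (a * z) = sqmod a * sqmod z.
Proof. by case: a z => [a b] [u v]; rewrite /sqmod /=; ring. Qed.

Let sqmodD (z w : R[i]) : sqmod (z + w) <= 2 * sqmod z + 2 * sqmod w.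
Proof.
case: z w => [a b] [u v]; rewrite /sqmod /= -subr_ge0.
rewrite (_ : _ - _ = (a - u) ^+ 2 + (b - v) ^+ 2); last by ring.
by rewrite addr_ge0 ?sqr_ge0.
Qed.

Let sqmod_ge0 (z : R[i]) : 0 <= sqmod z.
Proof. by rewrite /sqmod addr_ge0 ?sqr_ge0. Qed.

Let sqmod_measurable (f : X -> R[i]) :
  measurable_fun setT (Re \o f) -> measurable_fun setT (Im \o f) ->
  measurable_fun setT (EFin \o (fun x => sqmod (f x))).
Proof.
move=> mr mi; apply/measurable_EFinP.
by apply: measurable_funD; exact: measurable_funX.
Qed.

Lemma square_integrable_submod_closed :
  submod_closed (square_integrable_pred mu).
Proof.
split=> [|a f g /asboolP[fr fi fs] /asboolP[gr gi gs]]; apply/asboolP.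
  split; [exact: measurable_cst|exact: measurable_cst|].
  rewrite (eq_integral (cst 0%E)) ?integral0// => x _.
  by rewrite /sqmod /= expr0n /= addr0.
have ReE : Re \o (a *: f + g) =
    (fun x => Re a * Re (f x) - Im a * Im (f x)
              + Re (g x)).
  by apply/funext => x; exact: ReZD.
have ImE : Im \o (a *: f + g) =
    (fun x => Re a * Im (f x) + Im a * Re (f x)
              + Im (g x)).
  by apply/funext => x; exact: ImZD.
have hr : measurable_fun setT (Re \o (a *: f + g)).
  rewrite ReE; apply: measurable_funD => //.
  by apply: measurable_funB; apply: measurable_funM.
have hi : measurable_fun setT (Im \o (a *: f + g)).
  rewrite ImE; apply: measurable_funD => //.
  by apply: measurable_funD; apply: measurable_funM.
split=> //.
pose F x := ((2 * sqmod a)%:E * (sqmod (f x))%:E + 2%:E * (sqmod (g x))%:E)%E.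
apply: (@le_lt_trans _ _ (\int[mu]_x F x)%E).
  apply: ge0_le_integral => //.
  - by move=> x _; rewrite lee_fin.
  - exact: sqmod_measurable.
  - by apply: emeasurable_funD; apply: measurable_funeM; exact: sqmod_measurable.
  - move=> x _; rewrite /F -!EFinM -EFinD lee_fin -mulrA -sqmodZ.
    exact: sqmodD.
rewrite /F ge0_integralD//=; last 4 first.
- by move=> x _; rewrite -EFinM lee_fin !mulr_ge0.
- by apply: measurable_funeM; exact: sqmod_measurable.
- by move=> x _; rewrite -EFinM lee_fin !mulr_ge0.
- by apply: measurable_funeM; exact: sqmod_measurable.
rewrite !ge0_integralZl//; do ?[exact: sqmod_measurable];
  do ?[by move=> x _; rewrite lee_fin]; rewrite ?lee_fin ?mulr_ge0//.
by rewrite lte_add_pinfty// lte_mul_pinfty// lee_fin ?mulr_ge0.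
Qed.

HB.instance Definition _ := GRing.isSubmodClosed.Build R[i] (X -> R[i])
  (square_integrable_pred mu) square_integrable_submod_closed.
HB.instance Definition _ := [SubChoice_isSubLmodule of L2 mu by <:].

End L2_lmodType.

Section operators.
Context (R : realType) (d : measure_display) (X : measurableType d).
Variable mu : {measure set X -> \bar R}.

Definition L2_ip (f g : L2 mu) : R[i] := cintegral mu (fun x => f x * (g x)^*).

Definition L2_norm (f : L2 mu) : R := Num.sqrt (\int[mu]_x sqmod (f x)).

Definition bounded_operator (T : {linear L2 mu -> L2 mu}) : Prop :=
  exists K : R, forall f, L2_norm (T f) <= K * L2_norm f.

(* The value 0 is a default which is not used when T is bounded. *)
Definition adjoint (T : L2 mu -> L2 mu) : L2 mu -> L2 mu :=
  xget (fun=> 0) [set S | forall f g, L2_ip (T f) g = L2_ip f (S g)].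

Definition m_isometric (m : nat) (T : L2 mu -> L2 mu) : Prop :=
  forall f : L2 mu,
    \sum_(k < m.+1) ((-1) ^+ k * 'C(m, k)%:R) *: iter k (adjoint T) (iter k T f) = 0.

(* T is C_phi; that such a T exists says that C_phi is everywhere defined. *)
Definition is_composition_operator (phi : X -> X) (T : {linear L2 mu -> L2 mu}) : Prop :=
  forall f : L2 mu, T f = f \o phi :> (X -> R[i]).

Definition bounded_m_isometric_composition (m : nat) (phi : X -> X) : Prop :=
  exists T : {linear L2 mu -> L2 mu},
    [/\ is_composition_operator phi T, bounded_operator T & m_isometric m T].

End operators.

(* J_[1,eta], where eta = None stands for infinity. *)
Definition Jset (eta : option nat) : set nat :=
  [set i | (0 < i)%N /\ (if eta is Some n then (i <= n)%N else True)].

(* The indices of xc i = x_i and xb i j = x_{i,j} start at 1; the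
   values of xc and xb at other indices are irrelevant. *)
Record one_circuit (X : Type) (kappa : nat) (eta : option nat)
    (xc : nat -> X) (xb : nat -> nat -> X) (phi : X -> X) : Prop := OneCircuit {
  circuit_inj : forall i i', Jset (Some kappa) i -> Jset (Some kappa) i' ->
    xc i = xc i' -> i = i';
  branch_inj : forall i j i' j', Jset eta i -> (0 < j)%N -> Jset eta i' -> (0 < j')%N ->
    xb i j = xb i' j' -> i = i' /\ j = j';
  circuit_neq_branch : forall k i j, Jset (Some kappa) k -> Jset eta i -> (0 < j)%N ->
    xc k <> xb i j;
  vertices : forall v : X, (exists2 i, Jset (Some kappa) i & v = xc i) \/
    (exists i j, [/\ Jset eta i, (0 < j)%N & v = xb i j]);
  phi_branch : forall i j, Jset eta i -> (2 <= j)%N -> phi (xb i j) = xb i j.-1;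
  phi_branch1 : forall i, Jset eta i -> phi (xb i 1%N) = xc kappa;
  phi_circuit1 : phi (xc 1%N) = xc kappa;
  phi_circuit : forall i, (2 <= i <= kappa)%N -> phi (xc i) = xc i.-1 }.

Definition circuit_poly (R : realType) (kappa : nat) (t c d : R) : {poly R} :=
  (d / (2 * kappa%:R)) *: 'X^2
  + (c / kappa%:R - (kappa%:R + 2) / (2 * kappa%:R) * d) *: 'X
  + (- c + d + t)%:P.

Record circuit_weights (R : realType) (disp : measure_display)
    (X : measurableType disp) (mu : {measure set X -> \bar R}) (kappa : nat)
    (eta : option nat) (xc : nat -> X) (xb : nat -> nat -> X)
    (M t : R) (w : nat -> {poly R}) (c d : nat -> R) : Prop := CircuitWeights {
  M_gt0 : 0 < M;
  t_gt0 : 0 < t;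
  w_deg : forall i, Jset eta i -> (size (w i) <= 2)%N;
  c_gt0 : forall i, Jset eta i -> 0 < c i;
  d_ge0 : forall i, Jset eta i -> 0 <= d i;
  wE : forall i j, Jset eta i -> (0 < j)%N -> (w i).[j%:R] = c i + d i * (j%:R - 1);
  w_bound : (maxe (\esum_(i in Jset eta) ((w i).[1])%:E)
      (ereal_sup [set r | exists i j, [/\ Jset eta i, (0 < j)%N &
         r = ((w i).[j.+1%:R] / (w i).[j%:R])%:E]]) <= M%:E)%E;
  c_summable : (\esum_(i in Jset eta) (c i)%:E < +oo)%E;
  d_summable : (\esum_(i in Jset eta) (d i)%:E < +oo)%E;
  mu_branch : forall i j, Jset eta i -> (0 < j)%N ->
    mu [set xb i j] = (c i + d i * (j%:R - 1))%:E;
  mu_circuit : forall i, Jset (Some kappa) i ->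
    mu [set xc i] = ((circuit_poly kappa t (fine (\esum_(i in Jset eta) (c i)%:E))
                       (fine (\esum_(i in Jset eta) (d i)%:E))).[i%:R])%:E }.

(* Main.v *)
From HB Require Import structures.
Require Import Defs.
From mathcomp Require Import all_boot all_order all_algebra.
From mathcomp Require Import complex.
From mathcomp Require Import all_classical all_reals all_analysis.
From mathcomp Require Import measurable_realfun.
From mathcomp Require Import ring lra zify.

Set Implicit Arguments.
Unset Strict Implicit.
Unset Printing Implicit Defensive.

Import Order.TTheory GRing.Theory Num.Theory.

Local Open Scope classical_set_scope.
Local Open Scope ring_scope.

Local Notation Re := (@complex.Re _).
Local Notation Im := (@complex.Im _).
Local Notation "x %:C" := (real_complex _ x) : ring_scope.

(** Write C for the operator f |-> f o phi. The space is countable and discrete,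
    so C^*k C^k is multiplication by the function
      y |-> mu (phi^-k {y}) / mu {y},
    and C is bounded exactly when mu (phi^-1 {y}) <= K mu {y} for some constant
    K. Hence a bounded C is m-isometric if and only if
      sum_k (-1)^k 'C(m, k) mu (phi^-k {y}) = 0   for every point y
    ([bounded_m_isometric_compositionP]). By countable additivity the same
    relation holds for every set A of finite measure in place of {y}
    ([binomial_fiber_sum_set]); applied to the sets phi^-n A it says that the
    sequence n |-> mu (phi^-n A) has vanishing m-th differences, so for m = 3 it
    is a quadratic polynomial in n ([quadratic_of_recurrence]).

    The graph enters through the levels B_j = { x_(i, j) | i in J }. One has
    phi^-n x_(i, j) = x_(i, j + n), and, walking backwards along the circuit,
      phi^-r x_kappa = {x_r} U B_r  for 1 <= r <= kappa,
    which at r = kappa gives the relation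
      mu (phi^-(kappa + n) x_kappa) = mu (phi^-n x_kappa) + mu B_(kappa + n)
    ([measure_last_add]).

    If C is 3-isometric ([isometry3_weights]), the left-hand side and the first
    term on the right are values of one quadratic polynomial, so mu B_j is
    affine in j for j >= kappa. Each mu x_(i, j) is quadratic in j, nonnegative,
    and bounded by mu B_j: its leading coefficient vanishes, and then its slope
    is nonnegative. Comparing coefficients in the displayed relation determines
    the quadratic polynomial mu (phi^-n x_kappa) up to its constant term
    t = mu x_kappa, and mu x_r = mu (phi^-r x_kappa) - mu B_r is the polynomial
    of the theorem.

    Conversely, the weights of the theorem satisfy that relation, so an
    induction with step kappa shows that mu (phi^-n x_kappa) is a quadratic
    polynomial in n ([weights_last]); therefore all n |-> mu (phi^-n {y}) are
    quadratic and have vanishing third differences. The leading coefficient of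
    the polynomial at x_kappa is d / (2 kappa), so the second differences vanish
    exactly when d = 0, that is, when all the d_i vanish; this is the
    2-isometric case. *)

(** * Composition operators over a countable discrete measure space *)

Section DiscreteMeasure.
Context (R : realType) (disp : measure_display) (X : measurableType disp)
  (mu : {measure set X -> \bar R}).
Context (discrete : forall A : set X, measurable A).
Context (e : nat -> X) (e_inj : injective e)
  (e_surj : forall x, exists n, e n = x).
Context (mu_point : forall x, (0 < mu [set x] < +oo)%E).
Implicit Types (phi : X -> X) (a u : X -> R) (y : X) (K : R).

(** In the context of the section, where [//] finds it, this fact discharges the
    measurability conditions of the integration lemmas. *)
Let measurable_discrete d' (Y : measurableType d') (f : X -> Y) D :
  measurable_fun D f.
Proof. by move=> _ B _; exact: discrete. Qed.

Definition point_mass y : R := fine (mu [set y]).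
Local Notation m := point_mass.

Lemma point_massE y : mu [set y] = (m y)%:E.
Proof.
have /andP[h0 hoo] := mu_point y.
by rewrite fineK// ge0_fin_numE// ltW.
Qed.

Lemma point_mass_gt0 y : 0 < m y.
Proof. by rewrite -lte_fin -point_massE; case/andP: (mu_point y). Qed.

Lemma integral_point (f : X -> \bar R) y :
  (\int[mu]_(z in [set y]) f z = f y * (m y)%:E)%E.
Proof.
rewrite (eq_integral (cst (f y))) ?integral_cst ?point_massE//.
by move=> z; rewrite inE => ->.
Qed.

Let bigcup_fibers phi : \bigcup_n (phi @^-1` [set e n]) = setT.
Proof.
by apply/seteqP; split=> // x _; have [n en] := e_surj (phi x); exists n.
Qed.

Let trivIset_fibers phi : trivIset setT (fun n => phi @^-1` [set e n]).
Proof.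
move=> i j _ _ [x [/= px pj]]; apply: e_inj.
by rewrite -px -pj.
Qed.

(** The fibres of [phi] partition the space, so integration becomes summation
    over fibres; [phi := id] gives the summation over points. *)
Lemma ge0_integral_fibers phi (g : X -> \bar R) : (forall x, 0 <= g x)%E ->
  (\int[mu]_x g x =
   \sum_(n <oo) \int[mu]_(x in phi @^-1` [set e n]) g x)%E.
Proof.
by move=> g0; rewrite -(bigcup_fibers phi) ge0_integral_bigcup.
Qed.

Lemma integral_fibers phi (g : X -> \bar R) : mu.-integrable setT g ->
  (\int[mu]_x g x =
   \sum_(n <oo) \int[mu]_(x in phi @^-1` [set e n]) g x)%E.
Proof.
by move=> gi; rewrite -(bigcup_fibers phi) integral_bigcup ?bigcup_fibers.
Qed.

Lemma ge0_integral_points (g : X -> \bar R) : (forall x, 0 <= g x)%E ->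
  (\int[mu]_x g x = \sum_(n <oo) g (e n) * (m (e n))%:E)%E.
Proof.
move=> g0; rewrite (ge0_integral_fibers id)//.
by apply: eq_eseriesr => n _; rewrite -integral_point.
Qed.

Lemma integral_points (g : X -> \bar R) : mu.-integrable setT g ->
  (\int[mu]_x g x = \sum_(n <oo) g (e n) * (m (e n))%:E)%E.
Proof.
move=> gi; rewrite (@integral_fibers id)//.
by apply: eq_eseriesr => n _; rewrite -integral_point.
Qed.

Definition dominated phi K :=
  forall y, (mu (phi @^-1` [set y]) <= K%:E * mu [set y])%E.

Lemma integral_fiber_cst phi (g : X -> \bar R) y :
  (\int[mu]_(x in phi @^-1` [set y]) g (phi x) =
   g y * mu (phi @^-1` [set y]))%E.
Proof.
rewrite (eq_integral (cst (g y))) ?integral_cst//.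
by move=> z; rewrite inE => /= ->.
Qed.

(** On each fibre [g (phi x)] is constant, so the bound on the masses of the
    fibres can be used term by term. *)
Lemma integral_comp_le phi K (g : X -> \bar R) : dominated phi K ->
  (forall x, 0 <= g x)%E ->
  (\int[mu]_x g (phi x) <= K%:E * \int[mu]_x g x)%E.
Proof.
move=> domK g0; rewrite (ge0_integral_fibers phi)// ge0_integral_points//.
rewrite -nneseriesZl; last first.
  by move=> n _; rewrite mule_ge0// lee_fin ltW// point_mass_gt0.
apply: lee_nneseries => [n _ _|n _]; first exact: integral_ge0.
rewrite integral_fiber_cst muleCA lee_wpmul2l//.
by rewrite -point_massE.
Qed.

Lemma measure_comp_le phi K A : dominated phi K ->
  (mu (phi @^-1` A) <= K%:E * mu A)%E.
Proof.
move=> domK.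
have A0 x : (0 <= (\1_A x : R)%:E)%E by rewrite lee_fin.
by have := integral_comp_le domK A0; rewrite !integral_indic// !setIT.
Qed.

(** Membership in the real L^2 space; every function here is measurable. *)
Definition sq_summable a := (\int[mu]_x (a x ^+ 2)%:E < +oo)%E.

(** This is |a u| <= a^2 + u^2. *)
Lemma integrable_mul a u : sq_summable a -> sq_summable u ->
  mu.-integrable setT (EFin \o (a \* u)).
Proof.
move=> a2 u2; apply/integrableP; split; first exact: measurable_discrete.
apply: (@le_lt_trans _ _ (\int[mu]_x ((a x ^+ 2)%:E + (u x ^+ 2)%:E)%E)%E).
  apply: ge0_le_integral => //.
  move=> x _ /=; rewrite lee_fin ler_norml.
  by have := sqr_ge0 (a x + u x); have := sqr_ge0 (a x - u x); nra.
rewrite ge0_integralD//.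
- by rewrite lte_add_pinfty.
- by move=> x _; rewrite lee_fin sqr_ge0.
- by move=> x _; rewrite lee_fin sqr_ge0.
Qed.

(** The adjoint of the composition operator, on real functions. *)
Definition fiber_average phi u y : R :=
  \int[mu]_(x in phi @^-1` [set y]) u x / m y.

Section Dominated.
Context (phi : X -> X) (K : R).
Context (domK : dominated phi K).
Local Notation E := (fiber_average phi).

(** Fibres have finite mass, and |u| <= 1 + u^2. *)
Lemma integrable_fiber u y : sq_summable u ->
  mu.-integrable (phi @^-1` [set y]) (EFin \o u).
Proof.
move=> u2; apply/integrableP; split; first exact: measurable_discrete.
set F := phi @^-1` _.
apply: (@le_lt_trans _ _ (\int[mu]_(x in F) (1%:E + (u x ^+ 2)%:E)%E)%E).
  apply: ge0_le_integral => //.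
  move=> x _ /=; rewrite lee_fin ler_norml.
  by have := sqr_ge0 (u x + 1); have := sqr_ge0 (u x - 1); nra.
rewrite ge0_integralD//; last first.
  by move=> x _; rewrite lee_fin sqr_ge0.
rewrite lte_add_pinfty//.
  rewrite (integral_cst mu (discrete F)) mul1e.
  by rewrite (le_lt_trans (domK y))// point_massE -EFinM ltry.
apply: le_lt_trans u2; apply: ge0_subset_integral => //.
by move=> x _; rewrite lee_fin sqr_ge0.
Qed.

Lemma fiber_average_fineE u y : sq_summable u ->
  (\int[mu]_(x in phi @^-1` [set y]) (u x)%:E = (E u y * m y)%:E)%E.
Proof.
move=> u2; rewrite /fiber_average divfK ?gt_eqF ?point_mass_gt0//.
rewrite /Rintegral fineK//; apply: integrable_fin_num => //.
exact: integrable_fiber.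
Qed.

(** Both integrals are the same sum over [y]: on the fibre of [y] the factor
    [a (phi x)] is the constant [a y]. *)
Lemma integral_comp_mul a u : sq_summable a -> sq_summable u ->
  sq_summable (a \o phi) -> sq_summable (E u) ->
  \int[mu]_x (a (phi x) * u x) = \int[mu]_x (a x * E u x).
Proof.
move=> a2 u2 ap2 Eu2; congr fine.
rewrite (@integral_fibers phi); last exact: (integrable_mul ap2 u2).
rewrite integral_points; last exact: (integrable_mul a2 Eu2).
apply: eq_eseriesr => n _.
rewrite (eq_integral (fun x => (a (e n))%:E * (u x)%:E)%E); last first.
  by move=> x; rewrite inE => /= ->.
rewrite integralZl//; last exact: integrable_fiber.
by rewrite fiber_average_fineE// !EFinM muleA.
Qed.

Context (K_gt0 : 0 < K).

(** The Cauchy-Schwarz inequality on the fibre F of [y], with the mass of F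
    replaced by its bound K * m y. It is obtained by integrating
    2 c u <= u^2 + c^2 over F with c = E u y / K; this choice of c absorbs
    mu F <= K * m y without a division by mu F, which may be zero. *)
Lemma sq_fiber_average_le u y : sq_summable u ->
  (((E u y) ^+ 2 * m y)%:E <=
   K%:E * \int[mu]_(x in phi @^-1` [set y]) (u x ^+ 2)%:E)%E.
Proof.
move=> u2; set F := phi @^-1` _; set a := E u y.
have uF2 : (\int[mu]_(x in F) (u x ^+ 2)%:E < +oo)%E.
  apply: le_lt_trans u2; apply: ge0_subset_integral => //.
  by move=> x _; rewrite lee_fin sqr_ge0.
have uF0 : (0 <= \int[mu]_(x in F) (u x ^+ 2)%:E)%E.
  by apply: integral_ge0 => x _; rewrite lee_fin sqr_ge0.
have muF : (mu F < +oo)%E.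
  by rewrite (le_lt_trans (domK y))// point_massE -EFinM ltry.
have I1 : mu.-integrable F (fun x => (2 * (a / K))%:E * (u x)%:E)%E.
  by apply: integrableZl => //; exact: integrable_fiber.
have I2 : mu.-integrable F (fun x => (u x ^+ 2)%:E + ((a / K) ^+ 2)%:E)%E.
  apply: integrableD => //; apply/integrableP; split => //.
    rewrite (eq_integral (fun x => (u x ^+ 2)%:E))// => x _ /=.
    by rewrite ger0_norm ?sqr_ge0.
  by rewrite (integral_cst mu (discrete F)) lte_mul_pinfty.
have := le_integral (discrete F) I1 I2.
rewrite integralZl//; last exact: integrable_fiber.
rewrite fiber_average_fineE// ge0_integralD//; last 2 first.
- by move=> x _; rewrite lee_fin sqr_ge0.
- by move=> x _; rewrite lee_fin sqr_ge0.
rewrite (integral_cst mu (discrete F)) -/a.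
have -> : (\int[mu]_(x in F) (u x ^+ 2)%:E =
    (fine (\int[mu]_(x in F) (u x ^+ 2)%:E))%:E)%E.
  by rewrite fineK// ge0_fin_numE.
set I := fine _ => leI.
have {}leI :
    ((2 * (a / K) * (a * m y))%:E <= I%:E + ((a / K) ^+ 2)%:E * mu F)%E.
  apply: leI => x _; rewrite -EFinM -EFinD lee_fin.
  by have := sqr_ge0 (u x - a / K); nra.
have : ((2 * (a / K) * (a * m y))%:E <= I%:E + ((a / K) ^+ 2 * (K * m y))%:E)%E.
  apply: (le_trans leI); rewrite leeD2l// (EFinM (_ ^+ 2)).
  rewrite lee_wpmul2l ?lee_fin ?sqr_ge0//.
  by rewrite (le_trans (domK y))// point_massE.
rewrite -EFinD -EFinM !lee_fin.
have -> : 2 * (a / K) * (a * m y) = 2 * (a ^+ 2 * m y / K).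
  by field; rewrite gt_eqF.
have -> : (a / K) ^+ 2 * (K * m y) = a ^+ 2 * m y / K.
  by field; rewrite gt_eqF.
move=> h; rewrite (mulrC K) -ler_pdivrMr//; lra.
Qed.

Lemma sq_summable_fiber_average u : sq_summable u -> sq_summable (E u).
Proof.
move=> u2.
apply: (@le_lt_trans _ _ (K%:E * \int[mu]_x (u x ^+ 2)%:E)%E); last first.
  by rewrite lte_mul_pinfty// lee_fin ltW.
have sq0 (f : X -> R) x : (0 <= (f x ^+ 2)%:E)%E by rewrite lee_fin sqr_ge0.
rewrite (ge0_integral_fibers phi (sq0 u)) (ge0_integral_points (sq0 (E u))).
rewrite -nneseriesZl; last by move=> n _; exact: integral_ge0.
apply: lee_nneseries => [n _ _|n _].
  by rewrite mule_ge0// lee_fin ltW// point_mass_gt0.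
by rewrite -EFinM; exact: sq_fiber_average_le.
Qed.

End Dominated.

(** * The adjoint of a composition operator on L^2 *)

Lemma sq_summable_Re (f : X -> R[i]) : square_integrable mu f ->
  sq_summable (Re \o f).
Proof.
move=> [_ _]; apply: le_lt_trans; apply: ge0_le_integral => //.
- by move=> x _; rewrite lee_fin sqr_ge0.
- by move=> x _; rewrite lee_fin lerDl sqr_ge0.
Qed.

Lemma sq_summable_Im (f : X -> R[i]) : square_integrable mu f ->
  sq_summable (Im \o f).
Proof.
move=> [_ _]; apply: le_lt_trans; apply: ge0_le_integral => //.
- by move=> x _; rewrite lee_fin sqr_ge0.
- by move=> x _; rewrite lee_fin lerDr sqr_ge0.
Qed.

Lemma square_integrable_ReIm (f : X -> R[i]) :
  sq_summable (Re \o f) -> sq_summable (Im \o f) -> square_integrable mu f.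
Proof.
move=> f1 f2; split => //.
rewrite (eq_integral (fun x => (Re (f x) ^+ 2)%:E + (Im (f x) ^+ 2)%:E)%E)//.
rewrite ge0_integralD//; [by rewrite lte_add_pinfty| |].
- by move=> x _; rewrite lee_fin sqr_ge0.
- by move=> x _; rewrite lee_fin sqr_ge0.
Qed.

Lemma L2P (f : L2 mu) : square_integrable mu f.
Proof. exact/asboolP/(valP f). Qed.

Lemma sq_summable_comp phi K a : 0 < K -> dominated phi K ->
  sq_summable a -> sq_summable (a \o phi).
Proof.
move=> K0 domK a2.
have a0 x : (0 <= (a x ^+ 2)%:E)%E by rewrite lee_fin sqr_ge0.
apply: le_lt_trans (integral_comp_le domK a0) _.
by rewrite lte_mul_pinfty// lee_fin ltW.
Qed.

(** The adjoint of the composition operator, on complex functions. *)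
Definition cfiber_average phi (g : X -> R[i]) y : R[i] :=
  (Complex (fiber_average phi (Re \o g) y) (fiber_average phi (Im \o g) y))%R.

Lemma L2_cfiber_average phi K (g : L2 mu) : 0 < K -> dominated phi K ->
  cfiber_average phi g \in square_integrable_pred mu.
Proof.
move=> K0 domK; apply/asboolP; apply: square_integrable_ReIm.
  exact/(sq_summable_fiber_average domK K0)/sq_summable_Re/L2P.
exact/(sq_summable_fiber_average domK K0)/sq_summable_Im/L2P.
Qed.

Lemma L2_ip_fiber_average phi K (f g h k : L2 mu) : 0 < K -> dominated phi K ->
  h = f \o phi :> (X -> R[i]) -> k = cfiber_average phi g :> (X -> R[i]) ->
  L2_ip h g = L2_ip f k.
Proof.
move=> K0 domK hE kE; rewrite /L2_ip /cintegral.
have := L2P f; have := L2P g.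
move=> g2 f2; have := sq_summable_Re f2; have := sq_summable_Im f2.
have := sq_summable_Re g2; have := sq_summable_Im g2.
set u := Re \o g; set v := Im \o g; set a := Re \o f; set b := Im \o f.
move=> v2 u2 b2 a2.
have cS := fun a (h : sq_summable a) => sq_summable_comp K0 domK h.
have fS := fun a (h : sq_summable a) => sq_summable_fiber_average domK K0 h.
have H c w : sq_summable c -> sq_summable w ->
    \int[mu]_x (c (phi x) * w x) = \int[mu]_x (c x * fiber_average phi w x).
  by move=> c2 w2; apply: (integral_comp_mul domK) => //; [exact: cS|exact: fS].
congr (Complex _ _)%R.
- transitivity (\int[mu]_x (a (phi x) * u x + b (phi x) * v x)).
    apply: eq_Rintegral => x _; rewrite hE /a /b /u /v /=.
    by case: (f (phi x)) => ? ?; case: (g x) => ? ? /=; ring.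
  transitivity (\int[mu]_x (a x * fiber_average phi u x +
                             b x * fiber_average phi v x)).
    rewrite !RintegralD ?H//; apply: integrable_mul => //;
      by [exact: cS|exact: fS].
  apply: eq_Rintegral => x _; rewrite kE /cfiber_average /a /b /=.
  by case: (f x) => ? ? /=; rewrite -/u -/v; ring.
- transitivity (\int[mu]_x (b (phi x) * u x - a (phi x) * v x)).
    apply: eq_Rintegral => x _; rewrite hE /a /b /u /v /=.
    by case: (f (phi x)) => ? ?; case: (g x) => ? ? /=; ring.
  transitivity (\int[mu]_x (b x * fiber_average phi u x -
                             a x * fiber_average phi v x)).
    rewrite !RintegralB ?H//; apply: integrable_mul => //;
      by [exact: cS|exact: fS].
  apply: eq_Rintegral => x _; rewrite kE /cfiber_average /a /b /=.
  by case: (f x) => ? ? /=; rewrite -/u -/v; ring.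
Qed.

(** [adjoint] returns an adjoint only if there is one; the fibre averages show
    that there is. *)
Lemma adjoint_comp phi K (T : L2 mu -> L2 mu) : 0 < K -> dominated phi K ->
  (forall f, T f = f \o phi :> (X -> R[i])) ->
  forall f g, L2_ip (T f) g = L2_ip f (adjoint T g).
Proof.
move=> K0 domK Tphi.
apply: (@xgetPex _ _ [set S | forall f g, L2_ip (T f) g = L2_ip f (S g)]).
exists (fun g => MkL2 (L2_cfiber_average g K0 domK)) => f g.
exact: (L2_ip_fiber_average K0 domK).
Qed.

Lemma cintegral_indic (A : set X) (z : R[i]) :
  cintegral mu (fun x => (\1_A x : R)%:C * z) = (fine (mu A))%:C * z.
Proof.
have H (r : R) : \int[mu]_x (\1_A x * r) = fine (mu A) * r.
  rewrite [RHS]mulrC -Rintegral_cst// [RHS]Rintegral_mkcond.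
  apply: eq_Rintegral => x _.
  by rewrite patchE indicE; case: (x \in A); rewrite ?mul1r ?mul0r.
rewrite /cintegral; case: z => z1 z2.
transitivity (Complex (fine (mu A) * z1) (fine (mu A) * z2))%R.
  rewrite -!H; congr (Complex _ _)%R; apply: eq_Rintegral => x _ /=;
    by rewrite !mul0r ?subr0 ?addr0.
by apply/eqP; rewrite eq_complex /= !mul0r subr0 addr0 !eqxx.
Qed.

Lemma L2_indic y :
  (fun x => (\1_[set y] x : R)%:C) \in square_integrable_pred mu.
Proof.
apply/asboolP; split => //.
rewrite (eq_integral (fun x => (\1_[set y] x)%:E)).
  by rewrite integral_indic// setIT; case/andP: (mu_point y).
move=> x _; rewrite /sqmod /= expr0n /= addr0 indicE.
by case: (_ \in _); rewrite ?expr1n ?expr0n.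
Qed.

Definition indicL2 y : L2 mu := MkL2 (L2_indic y).

Definition fiber_mass phi k (A : set X) : R := fine (mu (iter k phi @^-1` A)).

Lemma iter_comp phi (T : L2 mu -> L2 mu) k f :
  (forall f, T f = f \o phi :> (X -> R[i])) ->
  iter k T f = f \o iter k phi :> (X -> R[i]).
Proof.
move=> Tphi; elim: k => [//|k IH]; rewrite iterS Tphi IH.
by apply/funext => x /=; rewrite -iterSr.
Qed.

(** Both sides of the adjoint relation are computed against the indicator of
    [y]: <C^k 1_y, C^k f> only sees the set phi^-k {y}, on which C^k f has the
    constant value [f y]. *)
Lemma adjoint_iter_comp phi K (T : L2 mu -> L2 mu) k f y : 0 < K ->
  dominated phi K -> (forall f, T f = f \o phi :> (X -> R[i])) ->
  iter k (adjoint T) (iter k T f) y = (fiber_mass phi k [set y] / m y)%:C * f y.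
Proof.
move=> K0 domK Tphi.
have adj j g h : L2_ip (iter j T g) h = L2_ip g (iter j (adjoint T) h).
  elim: j g h => [//|j IH] g h.
  by rewrite iterSr IH (adjoint_comp K0 domK Tphi) -iterS.
have := adj k (indicL2 y) (iter k T f).
set g := iter k (adjoint T) _.
have -> : L2_ip (indicL2 y) g = (m y)%:C * (g y)^*.
  rewrite -cintegral_indic /L2_ip; congr cintegral; apply/funext => x /=.
  rewrite indicE; case: (boolP (x \in _)); last by rewrite !mul0r.
  by rewrite inE => ->.
have -> : L2_ip (iter k T (indicL2 y)) (iter k T f) =
    (fiber_mass phi k [set y])%:C * (f y)^*.
  rewrite -cintegral_indic /L2_ip; congr cintegral; apply/funext => x.
  rewrite !(iter_comp _ _ Tphi) /= !indicE.
  have -> : (x \in iter k phi @^-1` [set y]) = (iter k phi x \in [set y]).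
    by apply/idP/idP; rewrite !inE.
  case: (boolP (_ \in _)); last by rewrite !mul0r.
  by rewrite inE => ->.
have := point_mass_gt0 y; case: (g y) => g1 g2; case: (f y) => f1 f2 my0 /eqP.
rewrite eq_complex /= !mul0r !subr0 !addr0 !mulrN eqr_opp.
move=> /andP[/eqP h1 /eqP h2].
apply/eqP; rewrite eq_complex /= !mul0r subr0 addr0.
have div (p r z : R) : r * p = m y * z -> z == r / m y * p.
  by move=> rp; rewrite mulrAC rp mulrC mulKf// gt_eqF.
by rewrite !div.
Qed.

Lemma L2_sumE (I : Type) (r : seq I) (F : I -> L2 mu) y :
  (\sum_(i <- r) F i) y = \sum_(i <- r) F i y.
Proof. by apply: (big_morph (fun h : L2 mu => h y)). Qed.

Definition binomial_fiber_sum n phi (A : set X) : R :=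
  \sum_(k < n.+1) (-1) ^+ k * 'C(n, k)%:R * fiber_mass phi k A.

(** By [adjoint_iter_comp] the operator sum is multiplication by the function
    [fun y => binomial_fiber_sum n phi [set y] / m y], hence zero if and only if
    it kills every indicator of a point. *)
Lemma m_isometric_comp phi K (T : L2 mu -> L2 mu) n : 0 < K ->
  dominated phi K -> (forall f, T f = f \o phi :> (X -> R[i])) ->
  m_isometric n T <-> forall y, binomial_fiber_sum n phi [set y] = 0.
Proof.
move=> K0 domK Tphi.
have H f y : (\sum_(k < n.+1) ((-1) ^+ k * 'C(n, k)%:R) *:
      iter k (adjoint T) (iter k T f)) y =
    (binomial_fiber_sum n phi [set y] / m y)%:C * f y.
  rewrite L2_sumE mulr_suml rmorph_sum mulr_suml; apply: eq_bigr => k _ /=.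
  transitivity
    (((-1) ^+ k * 'C(n, k)%:R) * iter k (adjoint T) (iter k T f) y) => //.
  rewrite (adjoint_iter_comp k f y K0 domK Tphi) mulrA; congr (_ * _).
  by rewrite !rmorphM /= rmorphXn /= rmorphN1 rmorph_nat !mulrA.
split=> [iso y|iso f]; last first.
  by apply: val_inj; apply/funext => y; rewrite [LHS]H iso mul0r rmorph0 mul0r.
have := H (indicL2 y) y; rewrite iso /= indicE mem_set// mulr1 => /esym/eqP.
rewrite eq_complex /= => /andP[+ _].
by rewrite mulf_eq0 invr_eq0 (gt_eqF (point_mass_gt0 y)) orbF => /eqP.
Qed.

Lemma L2_normE (f : L2 mu) :
  ((L2_norm f ^+ 2)%:E = \int[mu]_x (sqmod (f x))%:E)%E.
Proof.
have f0 : (0 <= \int[mu]_x (sqmod (f x))%:E)%E.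
  by apply: integral_ge0 => x _; rewrite lee_fin addr_ge0 ?sqr_ge0.
have [_ _ foo] := L2P f.
by rewrite /L2_norm sqr_sqrtr ?fine_ge0// /Rintegral fineK// ge0_fin_numE.
Qed.

(** Boundedness is tested on indicators of points: C 1_y is the indicator of the
    fibre of [y], and the squared norm of an indicator is a measure. *)
Lemma bounded_dominated phi (T : {linear L2 mu -> L2 mu}) :
  is_composition_operator phi T -> bounded_operator T ->
  exists2 K, 0 < K & dominated phi K.
Proof.
move=> Tphi [K Kb]; exists (K ^+ 2 + 1); first by rewrite ltr_wpDl ?sqr_ge0.
have sq (f : L2 mu) (A : set X) : f = (fun x => (\1_A x)%:C) :> (X -> R[i]) ->
    mu A = (L2_norm f ^+ 2)%:E.
  move=> fA; rewrite L2_normE fA (eq_integral (fun x => (\1_A x)%:E)).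
    by rewrite integral_indic// setIT.
  move=> x _; rewrite /sqmod /= expr0n /= addr0 indicE.
  by case: (_ \in _); rewrite ?expr1n ?expr0n.
move=> y; rewrite (sq (indicL2 y) [set y])//.
rewrite (sq (T (indicL2 y)) (phi @^-1` [set y])); last first.
  by rewrite Tphi; apply/funext => x /=; rewrite !indicE.
rewrite -EFinM lee_fin.
have := Kb (indicL2 y); set s := L2_norm (T _); set r := L2_norm _ => le_s.
have s0 : 0 <= s by rewrite sqrtr_ge0.
by have := sqr_ge0 r; have := sqr_ge0 (K * r); nra.
Qed.

Lemma dominated_bounded phi K : 0 < K -> dominated phi K ->
  exists2 T : {linear L2 mu -> L2 mu}, is_composition_operator phi T &
    bounded_operator T.
Proof.
move=> K0 domK.
have cL2 (f : L2 mu) : f \o phi \in square_integrable_pred mu.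
  apply/asboolP; apply: square_integrable_ReIm.
    exact/(sq_summable_comp K0 domK (a := Re \o f))/sq_summable_Re/L2P.
  exact/(sq_summable_comp K0 domK (a := Im \o f))/sq_summable_Im/L2P.
pose T0 (f : L2 mu) := MkL2 (cL2 f).
have linT : linear T0 by move=> c f g; apply: val_inj.
pose T : {linear L2 mu -> L2 mu} :=
  HB.pack T0 (GRing.isLinear.Build _ _ _ _ T0 linT).
exists T => //; exists (Num.sqrt K) => f.
rewrite -(@ler_pXn2r _ 2) ?nnegrE ?mulr_ge0 ?sqrtr_ge0//.
rewrite exprMn (sqr_sqrtr (ltW K0)) -lee_fin (EFinM K) !L2_normE.
by apply: (integral_comp_le domK) => x; rewrite lee_fin addr_ge0 ?sqr_ge0.
Qed.

Theorem bounded_m_isometric_compositionP n phi :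
  bounded_m_isometric_composition mu n phi <->
  (exists2 K, 0 < K & dominated phi K) /\
  forall y, binomial_fiber_sum n phi [set y] = 0.
Proof.
split=> [[T [Tphi Tb Tm]]|[[K K0 domK] H]].
  have [K K0 domK] := bounded_dominated Tphi Tb; split; first by exists K.
  exact/(m_isometric_comp n K0 domK Tphi).
have [T Tphi Tb] := dominated_bounded K0 domK.
by exists T; split=> //; exact/(m_isometric_comp n K0 domK Tphi).
Qed.

(** * From points to sets *)

Lemma fiber_mass_fin phi K k A : 0 < K -> dominated phi K -> (mu A < +oo)%E ->
  mu (iter k phi @^-1` A) = (fiber_mass phi k A)%:E.
Proof.
move=> K0 domK Aoo; rewrite /fiber_mass fineK// ge0_fin_numE//.
elim: k => [//|k IH].
have -> : iter k.+1 phi @^-1` A = phi @^-1` (iter k phi @^-1` A).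
  by apply/seteqP; split => x /=; rewrite -iterSr.
rewrite (le_lt_trans (measure_comp_le _ domK))//.
by rewrite lte_mul_pinfty// lee_fin ltW.
Qed.

(** The measures mu (phi^-k A) are the sums of mu (phi^-k {y}) over y in A. *)
Lemma binomial_fiber_sum_set phi K n A : 0 < K -> dominated phi K ->
  (forall y, binomial_fiber_sum n phi [set y] = 0) -> (mu A < +oo)%E ->
  binomial_fiber_sum n phi A = 0.
Proof.
move=> K0 domK H Aoo.
have fm0 k B : 0 <= fiber_mass phi k B by rewrite fine_ge0.
(* Series of nonnegative terms may be summed in any order, so the sum is cut
   into the part with even k and the part with odd k. *)
have side (P : pred nat) :
    (\sum_(k < n.+1 | P k) 'C(n, k)%:R * fiber_mass phi k A)%:E =
    (\sum_(j <oo) (\1_A (e j) *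
        \sum_(k < n.+1 | P k) 'C(n, k)%:R * fiber_mass phi k [set e j])%:E)%E.
  rewrite -sumEFin.
  transitivity (\sum_(j <oo) \sum_(k < n.+1 | P k)
      (\1_A (e j) * ('C(n, k)%:R * fiber_mass phi k [set e j]))%:E)%E;
    last first.
    by apply: eq_eseriesr => j _; rewrite sumEFin mulr_sumr.
  rewrite nneseries_sum; last by move=> k j _; rewrite lee_fin !mulr_ge0.
  apply: eq_bigr => k _.
  rewrite (EFinM _ (fiber_mass _ _ _)) -(fiber_mass_fin _ K0 domK Aoo).
  have A0 x : (0 <= (\1_A x : R)%:E)%E by rewrite lee_fin.
  have -> : mu (iter k phi @^-1` A) = (\int[mu]_x (\1_A (iter k phi x))%:E)%E.
    by rewrite -[iter k phi @^-1` A in LHS]setIT -integral_indic.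
  rewrite (@ge0_integral_fibers (iter k phi))// -nneseriesZl; last first.
    by move=> j _; exact: integral_ge0.
  apply: eq_eseriesr => j _.
  rewrite (integral_fiber_cst _ (fun x => (\1_A x)%:E)).
  rewrite (fiber_mass_fin _ K0 domK); last by case/andP: (mu_point (e j)).
  by rewrite -!EFinM mulrCA.
have split_sum B : binomial_fiber_sum n phi B =
    \sum_(k < n.+1 | ~~ odd k) 'C(n, k)%:R * fiber_mass phi k B -
    \sum_(k < n.+1 | odd k) 'C(n, k)%:R * fiber_mass phi k B.
  rewrite /binomial_fiber_sum (bigID (fun k : 'I_n.+1 => odd k)) /= addrC.
  congr (_ + _); rewrite -?sumrN; apply: eq_bigr => k ko.
    by rewrite -signr_odd (negbTE ko) mul1r.
  by rewrite -signr_odd ko mulN1r mulNr.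
rewrite split_sum; apply/eqP; rewrite subr_eq0 -(inj_eq (@EFin_inj R)).
rewrite (side (fun k => ~~ odd k)) (side odd); apply/eqP.
apply: eq_eseriesr => j _; congr ((_ * _)%:E).
by apply/eqP; rewrite -subr_eq0 -split_sum H.
Qed.

Lemma fiber_mass_iter phi j k A :
  fiber_mass phi k (iter j phi @^-1` A) = fiber_mass phi (j + k) A.
Proof.
rewrite /fiber_mass; congr (fine (mu _)).
by apply/seteqP; split => x /=; rewrite -iterD.
Qed.

(** This is the vanishing of the binomial sum at the set phi^-j A, which need
    not be a point even if A is one. *)
Lemma fiber_mass_recurrence2 phi K A j : 0 < K -> dominated phi K ->
  (forall y, binomial_fiber_sum 2 phi [set y] = 0) -> (mu A < +oo)%E ->
  let u k := fiber_mass phi k A in u j.+2 = 2 * u j.+1 - u j.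
Proof.
move=> K0 domK H Aoo u.
have Bfin : (mu (iter j phi @^-1` A) < +oo)%E.
  by rewrite (fiber_mass_fin _ K0 domK)// ltry.
have := binomial_fiber_sum_set K0 domK H Bfin.
rewrite /binomial_fiber_sum !big_ord_recr big_ord0 /= !fiber_mass_iter.
rewrite !addnS addn0 -/(u _) -/(u _) -/(u _) !binE /=; lra.
Qed.

Lemma fiber_mass_recurrence3 phi K A j : 0 < K -> dominated phi K ->
  (forall y, binomial_fiber_sum 3 phi [set y] = 0) -> (mu A < +oo)%E ->
  let u k := fiber_mass phi k A in u j.+3 = 3 * u j.+2 - 3 * u j.+1 + u j.
Proof.
move=> K0 domK H Aoo u.
have Bfin : (mu (iter j phi @^-1` A) < +oo)%E.
  by rewrite (fiber_mass_fin _ K0 domK)// ltry.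
have := binomial_fiber_sum_set K0 domK H Bfin.
rewrite /binomial_fiber_sum !big_ord_recr big_ord0 /= !fiber_mass_iter.
rewrite !addnS addn0 -/(u _) -/(u _) -/(u _) -/(u _) !binE /=; lra.
Qed.

(** The third difference at 0 is the difference of the second differences at 1
    and at 0. *)
Lemma binomial_fiber_sum2_3 phi K : 0 < K -> dominated phi K ->
  (forall y, binomial_fiber_sum 2 phi [set y] = 0) ->
  forall y, binomial_fiber_sum 3 phi [set y] = 0.
Proof.
move=> K0 domK H y; have yoo : (mu [set y] < +oo)%E by case/andP: (mu_point y).
have /= h0 := fiber_mass_recurrence2 0 K0 domK H yoo.
have /= h1 := fiber_mass_recurrence2 1 K0 domK H yoo.
rewrite /binomial_fiber_sum !big_ord_recr big_ord0 /= !binE /= h1 h0; ring.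
Qed.

End DiscreteMeasure.

(** * Polynomial sequences and sums of affine families *)

Section Sequences.
Context (R : realType).
Implicit Types (u : nat -> R) (A B C D : R).

Lemma quadratic_of_recurrence u :
  (forall j, u j.+3 = 3 * u j.+2 - 3 * u j.+1 + u j) ->
  let a := (u 2 - 2 * u 1 + u 0) / 2 in
  forall n, u n = u 0 + (u 1 - u 0 - a) * n%:R + a * n%:R ^+ 2.
Proof.
move=> H a n; pose q n := u 0 + (u 1 - u 0 - a) * n%:R + a * n%:R ^+ 2.
suff [] : [/\ u n = q n, u n.+1 = q n.+1 & u n.+2 = q n.+2] by [].
elim: n => [|n [h0 h1 h2]]; first by split; rewrite /q /a; field.
split=> //; rewrite H h0 h1 h2 /q -!natr1; ring.
Qed.

(** If C < 0, the value at any integer n > (|A| + |B|) / -C is negative. *)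
Lemma leading_coef_ge0 A B C :
  (forall n : nat, 0 <= A + B * n%:R + C * n%:R ^+ 2) -> 0 <= C.
Proof.
move=> H; rewrite leNgt; apply/negP => C0.
have x0 : 0 <= (`|A| + `|B|) / - C by rewrite divr_ge0 ?addr_ge0// oppr_ge0 ltW.
have := archi_boundP x0; set n := Num.bound _ => xn.
have n0 : (0 < n)%N by rewrite -(ltr_nat R) (le_lt_trans x0).
have n1 : 1 <= n%:R :> R by rewrite ler1n.
have := H n; apply/negP; rewrite -ltNge.
move: xn; rewrite ltr_pdivrMr ?oppr_gt0// => xn.
have hA := ler_norm A; have hB := ler_norm B; have A0 := normr_ge0 A.
have h1 : A <= `|A| * n%:R by rewrite (le_trans hA)// ler_peMr.
have h2 : B * n%:R <= `|B| * n%:R by rewrite ler_wpM2r.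
have h3 : (`|A| + `|B| + C * n%:R) * n%:R < 0.
  by rewrite pmulr_llt0 ?ltr0n//; lra.
by rewrite expr2; lra.
Qed.

Lemma esum_affine (J : set nat) (c d : nat -> R) C D :
  (forall i, J i -> 0 <= c i) -> (forall i, J i -> 0 <= d i) ->
  \esum_(i in J) (c i)%:E = C%:E -> \esum_(i in J) (d i)%:E = D%:E ->
  forall n : nat, \esum_(i in J) (c i + d i * n%:R)%:E = (C + D * n%:R)%:E.
Proof.
move=> c0 d0 cC dD; elim=> [|n IH].
  by rewrite mulr0 addr0 -cC; apply: eq_esum => i _; rewrite mulr0 addr0.
rewrite (_ : C + _ = C + D * n%:R + D); last by rewrite -natr1; ring.
rewrite EFinD -IH -dD -esumD => [|i Ji|i Ji].
- by apply: eq_esum => i _; rewrite -EFinD -natr1; congr EFin; ring.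
- by rewrite lee_fin addr_ge0 ?c0// mulr_ge0 ?d0.
- by rewrite lee_fin d0.
Qed.

End Sequences.

(** * Preimages in a graph with one circuit *)

Section Graph.
Context (X : Type) (kappa : nat) (eta : option nat)
  (xc : nat -> X) (xb : nat -> nat -> X) (phi : X -> X).
Context (kappa_gt0 : (0 < kappa)%N) (graph : one_circuit kappa eta xc xb phi).
Local Notation J := (Jset eta).

Definition branch_level j : set X := [set xb i j | i in J].
Local Notation B := branch_level.

Let circuit k : Jset (Some kappa) k = ((0 < k)%N /\ (k <= kappa)%N).
Proof. by []. Qed.

Let phi_xc k : Jset (Some kappa) k ->
  phi (xc k) = xc (if k == 1%N then kappa else k.-1).
Proof.
rewrite circuit => -[k0 kk]; case: eqP => [->|k1].
  exact: phi_circuit1 graph.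
by apply: (phi_circuit graph); rewrite kk andbT; lia.
Qed.

Let pred_circuit k : Jset (Some kappa) k ->
  Jset (Some kappa) (if k == 1%N then kappa else k.-1).
Proof. by rewrite !circuit => -[k0 kk]; case: eqP => k1; split; lia. Qed.

Let kappa_circuit : Jset (Some kappa) kappa.
Proof. by rewrite circuit. Qed.

Lemma preimage_branch i j : J i -> (0 < j)%N ->
  phi @^-1` [set xb i j] = [set xb i j.+1].
Proof.
move=> Ji j0; apply/seteqP; split=> v /=; last first.
  by move=> ->; rewrite (phi_branch graph).
case: (vertices graph v) => [[k kc ->]|[i' [j' [Ji' j'0 ->]]]].
  rewrite phi_xc// => /(circuit_neq_branch graph) []//.
  exact: pred_circuit.
have [j1|j1] := leqP j' 1.
  have -> : j' = 1%N by lia.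
  by rewrite (phi_branch1 graph)// => /(circuit_neq_branch graph) [].
rewrite (phi_branch graph)// => /(branch_inj graph)[//||//|//|-> <-]; first lia.
by rewrite prednK.
Qed.

Lemma preimage_circuit r : (0 < r < kappa)%N ->
  phi @^-1` [set xc r] = [set xc r.+1].
Proof.
move=> /andP[r0 rk]; apply/seteqP; split=> v /=; last first.
  by move=> ->; rewrite (phi_circuit graph)//; lia.
have rc : Jset (Some kappa) r by rewrite circuit; split; lia.
case: (vertices graph v) => [[k kc ->]|[i' [j' [Ji' j'0 ->]]]].
  rewrite phi_xc// => /(circuit_inj graph) -/(_ (pred_circuit kc) rc).
  move: kc; rewrite circuit => -[].
  by case: eqP => [|k1] ? ? ?; [lia|congr xc; lia].
have [j1|j1] := leqP j' 1.
  have -> : j' = 1%N by lia.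
  rewrite (phi_branch1 graph)// => /(circuit_inj graph).
  by move=> /(_ kappa_circuit rc); lia.
rewrite (phi_branch graph)// => /esym/(circuit_neq_branch graph) []//; lia.
Qed.

Lemma preimage_last :
  phi @^-1` [set xc kappa] = [set xc 1%N] `|` B 1.
Proof.
apply/seteqP; split=> v /=; last first.
  move=> [->|[i Ji <-]]; first exact: (phi_circuit1 graph).
  exact: (phi_branch1 graph).
case: (vertices graph v) => [[k kc ->]|[i' [j' [Ji' j'0 ->]]]].
  rewrite phi_xc// => /(circuit_inj graph).
  move=> /(_ (pred_circuit kc) kappa_circuit).
  by move: kc; rewrite circuit => -[]; case: eqP => [->|k1] ? ? ?; [left|lia].
have [j1|j1] := leqP j' 1.
  have -> : j' = 1%N by lia.
  by move=> _; right; exists i'.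
rewrite (phi_branch graph)// => /esym/(circuit_neq_branch graph) []//; lia.
Qed.

Lemma preimage_level j : (0 < j)%N -> phi @^-1` B j = B j.+1.
Proof.
move=> j0; apply/seteqP; split=> v /= [i Ji].
  move=> iv; exists i => //; symmetry.
  have : (phi @^-1` [set xb i j]) v by [].
  by rewrite preimage_branch.
by move=> <-; exists i => //; rewrite (phi_branch graph).
Qed.

Let preimage_iterD n r A :
  iter (r + n) phi @^-1` A = iter n phi @^-1` (iter r phi @^-1` A).
Proof. by apply/seteqP; split => x /=; rewrite iterD. Qed.

Let preimage_iterS r A :
  iter r.+1 phi @^-1` A = phi @^-1` (iter r phi @^-1` A).
Proof. by rewrite -addn1 preimage_iterD. Qed.

Lemma preimage_iter_branch n i j : J i -> (0 < j)%N ->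
  iter n phi @^-1` [set xb i j] = [set xb i (j + n)%N].
Proof.
move=> Ji j0; elim: n => [|n IH]; first by rewrite addn0.
by rewrite preimage_iterS IH preimage_branch// ?addnS// addn_gt0 j0.
Qed.

Lemma preimage_iter_level n j : (0 < j)%N ->
  iter n phi @^-1` B j = B (j + n).
Proof.
move=> j0; elim: n => [|n IH]; first by rewrite addn0.
by rewrite preimage_iterS IH preimage_level ?addnS// addn_gt0 j0.
Qed.

(** Walking backwards from x_kappa: the first step leads to x_1 and to the roots
    of the branches, and from then on the circuit and the branches advance
    together until the circuit closes at x_kappa. *)
Lemma preimage_iter_last r : (0 < r <= kappa)%N ->
  iter r phi @^-1` [set xc kappa] = [set xc r] `|` B r.
Proof.
elim: r => [//|[_ _|r IH rk]]; first exact: preimage_last.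
rewrite preimage_iterS IH; last lia.
by rewrite preimage_setU preimage_circuit ?preimage_level//; lia.
Qed.

Lemma preimage_iter_lastD n r : (0 < r <= kappa)%N ->
  iter (r + n) phi @^-1` [set xc kappa] =
  iter n phi @^-1` [set xc r] `|` B (r + n).
Proof.
move=> rk; rewrite preimage_iterD preimage_iter_last// preimage_setU.
by rewrite preimage_iter_level//; case/andP: rk.
Qed.

Lemma disjoint_circuit_level n r j : (0 < r <= kappa)%N -> (0 < j)%N ->
  [disjoint iter n phi @^-1` [set xc r] & B (j + n)].
Proof.
move=> /andP[r0 rk] j0; rewrite -preimage_iter_level//.
apply/disj_setPS => x [/= -> [i Ji]] /esym.
by apply: (circuit_neq_branch graph) => //.
Qed.

(** A single branch makes the graph infinite. *)
Lemma enumeration : (exists i, J i) ->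
  exists2 e : nat -> X, injective e & forall x, exists n, e n = x.
Proof.
move=> [i0 Ji0].
have inf : ~ finite_set [set: X].
  have finj : {in [set: nat] &, injective (fun j => xb i0 j.+1)}.
    by move=> j j' _ _ /(branch_inj graph)[]// _ [].
  move=> fX; apply: infinite_nat.
  rewrite -(eq_finite_set (inj_card_eq finj)).
  exact: sub_finite_set fX.
have cnt : countable [set: X].
  pose g (p : nat * nat) := if p.1 == 0%N then xc p.2 else xb p.1 p.2.
  apply: (@sub_countable _ _ _ [set: nat * nat]) => //.
  apply: card_le_trans (card_image_le g [set: nat * nat]).
  apply: subset_card_le => v _.
  case: (vertices graph v) => [[k kc ->]|[i [j [Ji j0 ->]]]].
    by exists (0%N, k).
  exists (i, j) => //; rewrite /g /=; case: eqP => // i00.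
  by move: Ji => -[]; rewrite i00.
have /card_set_bijP[f [_ finj fsurj]] := eq_card_nat cnt inf.
have /choice[e fe] : forall n, exists x, f x = n.
  by move=> n; have [x _ xn] := fsurj n I; exists x.
exists e => [n n' enn|x]; first by rewrite -(fe n) enn fe.
by exists (f x); apply: finj; rewrite ?inE.
Qed.

End Graph.

(** * Weights and differences *)

Lemma circuit_polyE (R : realType) (kappa : nat) (t c d x : R) :
  (circuit_poly kappa t c d).[x] =
  d / (2 * kappa%:R) * x ^+ 2 +
  (c / kappa%:R - (kappa%:R + 2) / (2 * kappa%:R) * d) * x + (- c + d + t).
Proof. by rewrite /circuit_poly !hornerE. Qed.

Section Weights.
Context (R : realType) (kappa : nat) (eta : option nat)
  (disp : measure_display) (X : measurableType disp)
  (mu : {measure set X -> \bar R})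
  (xc : nat -> X) (xb : nat -> nat -> X) (phi : X -> X).
Context (kappa_gt0 : (0 < kappa)%N) (graph : one_circuit kappa eta xc xb phi).
Context (discrete : forall A : set X, measurable A)
  (mu_point : forall x : X, (0 < mu [set x] < +oo)%E).
Local Notation J := (Jset eta).
Local Notation m := (point_mass mu).
Local Notation B := (branch_level eta xb).

Lemma measure_level j : (0 < j)%N ->
  mu (B j) = \esum_(i in J) (m (xb i j))%:E.
Proof.
move=> j0.
have -> : B j = \bigcup_(i in J) [set xb i j].
  by apply/seteqP; split=> v [i Ji]; [move=> <-|move=> ->]; exists i.
rewrite measure_bigcup//; last first.
  move=> i i' Ji Ji' [v [-> /(branch_inj graph)[]//]].
rewrite nneseries_esum// (_ : mkset _ = J); last first.
  by apply/seteqP; split=> i; rewrite /= inE.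
by apply: eq_esum => i Ji; rewrite (point_massE mu_point).
Qed.

(** The basic relation between the circuit and the branches. For [r = kappa] it
    relates two values of the sequence n |-> mu (phi^-n x_kappa); for the other
    [r] it expresses the masses at x_r through that sequence. *)
Lemma measure_last_add n r : (0 < r <= kappa)%N ->
  mu (iter (r + n) phi @^-1` [set xc kappa]) =
  (mu (iter n phi @^-1` [set xc r]) + mu (B (r + n)))%E.
Proof.
move=> rk; rewrite (preimage_iter_lastD kappa_gt0 graph)// measureU//.
by apply/disj_set2P/(disjoint_circuit_level _ graph) => //; case/andP: rk.
Qed.

Section FromWeights.
Context (M t : R) (w : nat -> {poly R}) (c d : nat -> R).
Context (W : circuit_weights mu kappa eta xc xb M t w c d).
Let C := fine (\esum_(i in J) (c i)%:E).
Let D := fine (\esum_(i in J) (d i)%:E).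

Let c_fin : \esum_(i in J) (c i)%:E = C%:E.
Proof.
rewrite /C fineK// ge0_fin_numE ?(c_summable W)//.
by apply: esum_ge0 => i Ji; rewrite lee_fin ltW// (c_gt0 W).
Qed.

Let d_fin : \esum_(i in J) (d i)%:E = D%:E.
Proof.
rewrite /D fineK// ge0_fin_numE ?(d_summable W)//.
by apply: esum_ge0 => i Ji; rewrite lee_fin (d_ge0 W).
Qed.

Lemma weights_level j : (0 < j)%N -> mu (B j) = (C + D * (j%:R - 1))%:E.
Proof.
case: j => [//|j] _; rewrite measure_level// -natr1 addrK.
rewrite -(esum_affine _ _ c_fin d_fin); last 2 first.
- by move=> i Ji; rewrite ltW// (c_gt0 W).
- by move=> i Ji; rewrite (d_ge0 W).
apply: eq_esum => i Ji; rewrite /m (mu_branch W)//= -natr1.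
by rewrite addrK.
Qed.

(** The polynomial P of degree at most 2 with P 0 = t and
    P (n + kappa) - P n = C + D (n + kappa - 1). *)
Definition last_mass (n : nat) : R :=
  t + (C / kappa%:R + (kappa%:R - 2) / (2 * kappa%:R) * D) * n%:R
    + D / (2 * kappa%:R) * n%:R ^+ 2.

Let kappa_neq0 : kappa%:R != 0 :> R.
Proof. by rewrite pnatr_eq0 -lt0n. Qed.

(** The circuit polynomial takes the value t at kappa, which is the case n = 0;
    for 1 <= n <= kappa its value at n is [last_mass n] minus the mass of the
    level B_n; beyond kappa, both sides satisfy the same relation of step
    kappa. *)
Lemma weights_last n : mu (iter n phi @^-1` [set xc kappa]) = (last_mass n)%:E.
Proof.
have [k] := ubnP n; elim: k n => [//|k IH] [_|n nk].
  rewrite [LHS](mu_circuit W) /=; last by split.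
  by rewrite circuit_polyE -/C -/D /last_mass; congr EFin; field.
have [nkappa|kn] := leqP n.+1 kappa.
  have := @measure_last_add 0 n.+1; rewrite addn0 => -> //.
  rewrite /= (mu_circuit W) ?weights_level//.
  by rewrite -EFinD circuit_polyE -/C -/D /last_mass; congr EFin; field.
rewrite -(subnKC (ltnW kn)) measure_last_add ?kappa_gt0//=.
rewrite IH ?weights_level ?addn_gt0 ?kappa_gt0//; last lia.
rewrite -EFinD /last_mass natrD; congr EFin; field.
by [].
Qed.

Lemma weights_circuit n r : (0 < r <= kappa)%N ->
  mu (iter n phi @^-1` [set xc r]) =
  (last_mass (r + n) - (C + D * ((r + n)%:R - 1)))%:E.
Proof.
move=> rk; have rn : (0 < r + n)%N by rewrite addn_gt0; case/andP: rk => ->.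
have := measure_last_add n rk.
rewrite weights_last weights_level// => lastE.
by rewrite EFinB lastE addeK.
Qed.

Lemma weights_branch n i j : J i -> (0 < j)%N ->
  mu (iter n phi @^-1` [set xb i j]) = (c i + d i * ((j + n)%:R - 1))%:E.
Proof.
move=> Ji j0; rewrite (preimage_iter_branch kappa_gt0 graph)//.
by rewrite (mu_branch W)// addn_gt0 j0.
Qed.

Lemma weights_isometry3 y : binomial_fiber_sum mu 3 phi [set y] = 0.
Proof.
rewrite /binomial_fiber_sum !big_ord_recr big_ord0 /= !binE /= /fiber_mass.
case: (vertices graph y) => [[r [r0 rk] ->]|[i [j [Ji j0 ->]]]].
  rewrite !weights_circuit ?r0//=; rewrite /last_mass !natrD; field.
  exact: kappa_neq0.
rewrite !weights_branch//= !natrD; ring.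
Qed.

Lemma weights_isometry2 : (forall i, J i -> d i = 0) ->
  forall y, binomial_fiber_sum mu 2 phi [set y] = 0.
Proof.
move=> d0 y.
have D0 : D = 0.
  by rewrite /D esum1// => i Ji; rewrite d0.
rewrite /binomial_fiber_sum !big_ord_recr big_ord0 /= !binE /= /fiber_mass.
case: (vertices graph y) => [[r [r0 rk] ->]|[i [j [Ji j0 ->]]]].
  rewrite !weights_circuit ?r0//=; rewrite /last_mass !natrD D0; field.
  exact: kappa_neq0.
rewrite !weights_branch//= !natrD d0//; ring.
Qed.

(** The second difference of [last_mass] is D / kappa, and the d_i are
    nonnegative with sum D. *)
Lemma isometry2_weights : binomial_fiber_sum mu 2 phi [set xc kappa] = 0 ->
  forall i, J i -> d i = 0.
Proof.
rewrite /binomial_fiber_sum !big_ord_recr big_ord0 /= !binE /= /fiber_mass.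
rewrite !weights_last /= /last_mass => H i Ji.
have D0 : D = 0.
  have : D / kappa%:R = 0 by rewrite -[RHS]H; field.
  by move/eqP; rewrite mulf_eq0 invr_eq0 (negbTE kappa_neq0) orbF => /eqP.
apply/eqP; rewrite eq_le (d_ge0 W)// andbT -lee_fin -D0 -d_fin.
apply: esum_ge; exists [set i]; last by rewrite fsbig_set1.
by split=> // _ ->.
Qed.

(** On the branches M bounds the ratios; the circuit contributes finitely many
    further ratios, which are added up. *)
Lemma weights_dominated : exists2 K, 0 < K & dominated mu phi K.
Proof.
pose q (r : 'I_kappa.+1) := `|fiber_mass mu phi 1 [set xc r] / m (xc r)|.
have M0 := M_gt0 W.
have q0 : 0 <= \sum_r q r by apply: sumr_ge0 => r _; exact: normr_ge0.
exists (M + \sum_r q r); first by rewrite ltr_pwDl.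
move=> y; rewrite (point_massE mu_point) -EFinM.
have my0 := point_mass_gt0 mu_point y.
case: (vertices graph y) => [[r [r0 rk] yE]|[i [j [Ji j0 yE]]]].
  have -> : mu (phi @^-1` [set y]) = (fiber_mass mu phi 1 [set xc r])%:E.
    by rewrite /fiber_mass weights_circuit ?r0//= -weights_circuit ?r0// yE.
  have rk' : (r < kappa.+1)%N by [].
  have := ler_norm (fiber_mass mu phi 1 [set xc r] / m (xc r)).
  rewrite lee_fin -ler_pdivrMr// -yE => /le_trans -> //.
  rewrite (bigD1 (Ordinal rk'))//= {1}/q /= -yE.
  rewrite addrCA lerDl addr_ge0//; first exact: ltW.
  by apply: sumr_ge0 => k _; exact: normr_ge0.
have := weights_branch 1 Ji j0; rewrite /= -yE => ->.
have -> : m y = c i + d i * (j%:R - 1) by rewrite /m yE (mu_branch W).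
have := w_bound W; rewrite ge_max => /andP[_ sup].
have : (((w i).[j.+1%:R] / (w i).[j%:R])%:E <= M%:E)%E.
  by apply: le_trans sup; apply: ereal_sup_ubound; exists i, j.
rewrite !(wE W)// lee_fin addn1.
have my : 0 < c i + d i * (j%:R - 1).
  by rewrite -lte_fin -(mu_branch W)//; case/andP: (mu_point (xb i j)).
rewrite ler_pdivrMr// lee_fin => /le_trans -> //.
by rewrite ler_pM2r// lerDl.
Qed.

End FromWeights.

(** The witnesses are t = mu x_kappa, c_i = mu x_(i, 1),
    d_i = mu x_(i, 2) - mu x_(i, 1) and M = K + mu B_1 + 1: the domination
    constant K bounds the ratios along the branches, and the w_i(1) add up to
    mu B_1. *)
Theorem isometry3_weights K : (exists i, J i) -> 0 < K -> dominated mu phi K ->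
  (forall y, binomial_fiber_sum mu 3 phi [set y] = 0) ->
  exists (M t : R) (c d : nat -> R), circuit_weights mu kappa eta xc xb M t
    (fun i => (c i - d i)%:P + d i *: 'X) c d.
Proof.
move=> Jn0 K0 domK H3.
have [e e_inj e_surj] := enumeration graph Jn0.
have mass_fin n A := @fiber_mass_fin _ _ _ _ discrete _ e_inj e_surj mu_point
  phi K n A K0 domK.
have rec3 A Aoo j := fiber_mass_recurrence3 discrete e_inj e_surj mu_point
  (A := A) j K0 domK H3 Aoo.
have [k kE] : exists k, kappa = k.+1 by exists kappa.-1; rewrite prednK.
have pt_fin y : (mu [set y] < +oo)%E by case/andP: (mu_point y).
pose u n := fiber_mass mu phi n [set xc kappa].
have uE n : mu (iter n phi @^-1` [set xc kappa]) = (u n)%:E.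
  exact: mass_fin.
pose S j := fine (mu (B j)).
have SE j : (0 < j)%N -> mu (B j) = (S j)%:E.
  case: j => // n _; rewrite /S fineK// ge0_fin_numE//.
  rewrite -add1n -(preimage_iter_level kappa_gt0 graph)//.
  rewrite mass_fin ?ltry//.
  have := uE 1%N; rewrite [iter 1 phi]/= (preimage_last kappa_gt0 graph) => h.
  by apply: (@le_lt_trans _ _ (u 1%N)%:E); rewrite ?ltry// -h le_measure ?inE.
have uS n : u (kappa + n)%N = u n + S (kappa + n)%N.
  apply: (@EFin_inj R); rewrite EFinD -!uE -SE ?addn_gt0 ?kappa_gt0//.
  by rewrite measure_last_add ?kappa_gt0/=.
have /= := quadratic_of_recurrence (rec3 _ (pt_fin (xc kappa))).
rewrite -/(u _) -/(u _) -/(u _).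
set a := _ / 2; set b := _ - a => uq.
have [t tE {}uq] : exists2 t, t = u 0 &
    forall n, u n = t + b * n%:R + a * n%:R ^+ 2 by exists (u 0).
clearbody a b.
pose W i j := m (xb i j).
have W0 i j : 0 < W i j by exact: point_mass_gt0.
have Wfm i n : J i -> W i n.+1 = fiber_mass mu phi n [set xb i 1%N].
  by move=> Ji; rewrite /fiber_mass (preimage_iter_branch kappa_gt0 graph).
have WleS i j : J i -> (0 < j)%N -> W i j <= S j.
  move=> Ji j0; rewrite -lee_fin -SE// -point_massE//.
  by rewrite le_measure ?inE// => v ->; exists i.
have Wlin i n : J i -> W i n.+1 = W i 1%N + (W i 2%N - W i 1%N) * n%:R.
  move=> Ji; have := quadratic_of_recurrence (rec3 _ (pt_fin (xb i 1%N))).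
  rewrite /= -!Wfm//; set ai := _ / 2; set bi := _ - ai => Wq.
  have {}Wq l : W i l.+1 = W i 1%N + bi * l%:R + ai * l%:R ^+ 2.
    by rewrite Wfm// Wq.
  have biE : bi = W i 2%N - W i 1%N - ai by [].
  clearbody ai bi.
  have ai_ge0 : 0 <= ai.
    apply: (leading_coef_ge0 (A := W i 1%N) (B := bi)) => l.
    by rewrite -Wq ltW.
  (* S (kappa + l) = u (kappa + l) - u l is affine in l and bounds
     W i (kappa + l); the coefficients A and B below are those of the
     difference, whose leading coefficient is - ai. *)
  have ai_le0 : 0 <= - ai.
    apply: (leading_coef_ge0
      (A := b * kappa%:R + a * kappa%:R ^+ 2
            - W i 1%N - bi * k%:R - ai * k%:R ^+ 2)
      (B := 2 * a * kappa%:R - bi - 2 * ai * k%:R)) => l.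
    have := WleS i (kappa + l)%N Ji; rewrite addn_gt0 kappa_gt0 => /(_ isT).
    have -> : S (kappa + l)%N = u (kappa + l)%N - u l by rewrite uS addrC addKr.
    rewrite {1}kE addSn Wq !uq !natrD; lra.
  have ai0 : ai = 0 by lra.
  by rewrite Wq biE ai0; ring.
pose c i := W i 1%N; pose d i := W i 2%N - W i 1%N.
have c0 i : J i -> 0 <= c i by move=> _; exact: ltW (W0 i 1%N).
have d0 i : J i -> 0 <= d i.
  (* The affine sequence W i is nonnegative at the squares, where it is a
     quadratic polynomial in l with leading coefficient d i. *)
  move=> Ji; apply: (leading_coef_ge0 (A := W i 1%N) (B := 0)) => l.
  by rewrite mul0r addr0 -natrX -Wlin// ltW.
have Wcd i j : J i -> (0 < j)%N -> m (xb i j) = c i + d i * (j%:R - 1).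
  by case: j => // j Ji _; rewrite -/(W _ _) Wlin// -natr1 addrK.
pose C := S 1%N; pose D := fine (\esum_(i in J) (d i)%:E).
have cC : \esum_(i in J) (c i)%:E = C%:E by rewrite -SE// measure_level.
have dD : \esum_(i in J) (d i)%:E = D%:E.
  rewrite fineK// ge0_fin_numE; last first.
    by apply: esum_ge0 => i Ji; rewrite lee_fin d0.
  apply: (@le_lt_trans _ _ (S 2%N)%:E); rewrite ?ltry// -SE// measure_level//.
  by apply: le_esum => i Ji; rewrite lee_fin lerBlDr lerDl c0.
have c_pos i : J i -> 0 < c i by move=> _; exact: W0 i 1%N.
clearbody c d.
have Slin n : S n.+1 = C + D * n%:R.
  apply: (@EFin_inj R); rewrite -SE// measure_level//.
  rewrite -(esum_affine c0 d0 cC dD).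
  by apply: eq_esum => i Ji; rewrite Wcd// -natr1 addrK.
have kappa_neq0 : kappa%:R != 0 :> R by rewrite pnatr_eq0 -lt0n.
have kR : k%:R = kappa%:R - 1 :> R by rewrite kE -natr1 addrK.
(* a and b are read off from the relation for u at 0 and 1. *)
have h0 := uS 0%N; have h1 := uS 1%N.
have aE : a = D / (2 * kappa%:R).
  move: h0 h1; rewrite addn0 addn1 !uq kE !Slin -kE -natr1 kR => h0 h1.
  have k2 : 2 * kappa%:R != 0 :> R.
    by apply: mulf_neq0; rewrite ?kappa_neq0 ?pnatr_eq0.
  apply: (mulIf k2); rewrite divfK//; lra.
have bE : b = C / kappa%:R + (kappa%:R - 2) / (2 * kappa%:R) * D.
  move: h0; rewrite addn0 !uq kE Slin -kE kR => h0.
  have -> : b = (C + D * (kappa%:R - 1) - a * kappa%:R ^+ 2) / kappa%:R.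
    by apply: (mulIf kappa_neq0); rewrite divfK//; lra.
  by rewrite aE; field.
exists (K + C + 1), t, c, d; split => //.
- rewrite -addrA ltr_pwDl// addr_ge0// -lee_fin -cC.
  by apply: esum_ge0 => i Ji; rewrite lee_fin c0.
- by rewrite tE /u /fiber_mass /= point_mass_gt0.
- move=> i Ji.
  apply: (leq_trans (size_polyD _ _)); rewrite geq_max.
  rewrite (leq_trans (size_polyC_leq1 _))//.
  by rewrite (leq_trans (size_scale_leq _ _))// size_polyX.
- move=> i j Ji j0; rewrite !hornerE; ring.
- have C0 : 0 <= C.
    by rewrite -lee_fin -cC; apply: esum_ge0 => i Ji; rewrite lee_fin c0.
  rewrite ge_max; apply/andP; split.
    rewrite (eq_esum (b := fun i => (c i)%:E)).
      by rewrite cC lee_fin; lra.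
    by move=> i Ji; rewrite !hornerE; congr EFin; ring.
  apply: ge_ereal_sup => _ [i [j [Ji j0 ->]]].
  have wl l : (0 < l)%N -> ((c i - d i)%:P + d i *: 'X).[l%:R] = m (xb i l).
    by move=> l0; rewrite !hornerE Wcd//; ring.
  have := domK (xb i j); rewrite (preimage_branch kappa_gt0 graph)//.
  rewrite !(point_massE mu_point) -EFinM lee_fin => WK.
  rewrite !wl// lee_fin ler_pdivrMr; last exact: W0.
  apply: (le_trans WK).
  by rewrite ler_wpM2r -?addrA ?lerDl ?addr_ge0//; exact: ltW (W0 i j).
- by rewrite cC ltry.
- by rewrite dD ltry.
- by move=> i j Ji j0; rewrite point_massE// Wcd.
- move=> i [i0 ik]; rewrite cC dD /=.
  have := measure_last_add 0 (r := i); rewrite addn0 i0 ik => /(_ isT).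
  rewrite uE SE//= point_massE// -EFinD => -[] uSi.
  congr EFin; rewrite circuit_polyE.
  have -> : m (xc i) = u i - S i by rewrite uSi addrK.
  case: i i0 {ik uSi} => // i _; rewrite Slin uq bE aE -natr1.
  by field.
Qed.

End Weights.

Theorem theorem3p5 (R : realType) (kappa : nat) (eta : option nat)
    (disp : measure_display) (X : measurableType disp)
    (mu : {measure set X -> \bar R})
    (xc : nat -> X) (xb : nat -> nat -> X) (phi : X -> X)
    (kappa_gt1 : (1 < kappa)%N)
    (eta_gt0 : forall n : nat, eta = Some n -> (0 < n)%N)
    (graph : one_circuit kappa eta xc xb phi)
    (discrete : forall A : set X, measurable A)
    (mu_point : forall x : X, (0 < mu [set x] < +oo)%E) :
  (bounded_m_isometric_composition mu 3 phi <->
   exists (M t : R) (w : nat -> {poly R}) (c d : nat -> R),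
     circuit_weights mu kappa eta xc xb M t w c d) /\
  (bounded_m_isometric_composition mu 2 phi <->
   exists (M t : R) (w : nat -> {poly R}) (c d : nat -> R),
     circuit_weights mu kappa eta xc xb M t w c d /\
     forall i, Jset eta i -> size (w i) = 1%N /\ d i = 0).
Proof.
have kappa_gt0 : (0 < kappa)%N by exact: ltnW.
have branch1 : exists i, Jset eta i.
  exists 1%N; split=> //; case: (eta) eta_gt0 => [n|//] /(_ n erefl).
  by [].
have [e e_inj e_surj] := enumeration graph branch1.
have iso n := bounded_m_isometric_compositionP discrete e_inj e_surj mu_point
  n phi.
have weights3 := isometry3_weights kappa_gt0 graph discrete mu_point branch1.
split; split.
- move=> /iso[[K K_gt0 domK] H3].
  have [M [t [c [d W]]]] := weights3 K K_gt0 domK H3.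
  by exists M, t, (fun i => (c i - d i)%:P + d i *: 'X), c, d.
- move=> [M [t [w [c [d W]]]]]; apply/iso; split.
    exact: (weights_dominated kappa_gt0 graph discrete mu_point W).
  exact: (weights_isometry3 kappa_gt0 graph discrete mu_point W).
- move=> /iso[[K K_gt0 domK] H2].
  have H3 := binomial_fiber_sum2_3 discrete e_inj e_surj mu_point K_gt0 domK H2.
  have [M [t [c [d W]]]] := weights3 K K_gt0 domK H3.
  exists M, t, (fun i => (c i - d i)%:P + d i *: 'X), c, d; split=> // i Ji.
  have d0 : d i = 0.
    exact: (isometry2_weights kappa_gt0 graph discrete mu_point W (H2 _)).
  split=> //; rewrite d0 scale0r addr0 subr0 size_polyC.
  by rewrite gt_eqF// (c_gt0 W).
- move=> [M [t [w [c [d [W wd]]]]]]; apply/iso; split.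
    exact: (weights_dominated kappa_gt0 graph discrete mu_point W).
  apply: (weights_isometry2 kappa_gt0 graph discrete mu_point W) => i Ji.
  by have [] := wd i Ji.
Qed.
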